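(* Let $A\in\mathbb{Z}$ with $A\equiv 1\pmod 4$, and for an integer $n\ge 3$ let \[\mathcal{F}_{n,A,A}(x)=x^{2^n}+Ax^{3\cdot 2^{n-2}}+Ax^{2^{n-1}}+Ax^{2^{n-2}}+1.\] Then $\mathcal{F}_{n,A,A}(x)$ is not monogenic.
   Context: A monic polynomial $f(x)\in\mathbb{Z}[x]$ is called monogenic if $f(x)$ is irreducible over $\mathbb{Q}$ and $\{1,\theta,\ldots,\theta^{\deg f-1}\}$ is a $\mathbb{Z}$-basis of the ring of integers of $\mathbb{Q}(\theta)$, where $f(\theta)=0$. *)

(* Defs.v *)
From HB Require Import structures.
From mathcomp Require Import all_boot all_order all_algebra all_field.

Set Implicit Arguments.
Unset Strict Implicit.
Unset Printing Implicit Defensive.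

Import Order.TTheory GRing.Theory Num.Theory.
Local Open Scope ring_scope.

Definition in_ring_of_integers (L : fieldExtType rat) (K : {subfield L})
    (x : L) : Prop :=
  x \in K /\ integralOver (intr : int -> L) x.

Definition Zbasis (V : zmodType) (M : V -> Prop) (d : nat) (b : 'I_d -> V) :
    Prop :=
  (forall x : V, M x <-> exists c : 'I_d -> int, x = \sum_(i < d) b i *~ c i)
  /\ (forall c : 'I_d -> int,
        \sum_(i < d) b i *~ c i = 0 -> forall i : 'I_d, c i = 0).

(* [<<1; theta>>] is Q(theta), generated inside an arbitrary finite extension
   [L] of Q.  When f is irreducible such a root exists, and the choice of [L]
   and [theta] is immaterial, all the fields Q(theta) being isomorphic. *)
Definition monogenic (f : {poly int}) : Prop :=
  [/\ f \is monic,
      irreducible_poly (map_poly (intr : int -> rat) f)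
    & exists (L : fieldExtType rat) (theta : L),
        root (map_poly (intr : int -> L) f) theta
        /\ Zbasis (in_ring_of_integers <<1; theta>>%AS)
             (fun i : 'I_(size f).-1 => theta ^+ i)].

Definition calF_AA (n : nat) (A : int) : {poly int} :=
  'X^(2 ^ n)%N + A *: 'X^(3 * 2 ^ (n - 2))%N + A *: 'X^(2 ^ (n - 1))%N
  + A *: 'X^(2 ^ (n - 2))%N + 1.

(* Main.v *)
(** Put m = 2^(n-2) and P = 1 + x + x^2 + x^3 + x^4, so that f = F_{n,A,A} is
    P(x^m) + 4 R for some R.  As P(x^2) = P(x) P(-x), one has P(x^m) = P h with
    h = P^(m-1) + 2 s for some s in Z[x].  At a root theta of f this gives
    P h = -4 R, so a = h(theta) / 2 satisfies
      a^2 = a (P^(m-1) / 2 + s) = s a - R P^(m-2)   (m >= 2),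
    and a is integral over Z[theta].  But a is not in Z[theta], because
    deg h < deg f while the constant coefficient of h is 1. *)
Require Import Defs.
From HB Require Import structures.
From mathcomp Require Import all_boot all_order all_algebra all_field.
From mathcomp Require Import ring zify.

Set Implicit Arguments.
Unset Strict Implicit.
Unset Printing Implicit Defensive.

Import Order.TTheory GRing.Theory Num.Theory.
Local Open Scope ring_scope.

(** The fifth cyclotomic polynomial, as a function on any ring so that it also applies to ['X^m] and
    [- y]. *)
Definition phi5 (R : nzRingType) (x : R) : R := x ^+ 4 + x ^+ 3 + x ^+ 2 + x + 1.

Lemma size_phi5_Xn (R : nzRingType) (m : nat) :
  (0 < m)%N -> size (phi5 ('X^m : {poly R})) = (4 * m).+1.
Proof.
move=> m_gt0; rewrite /phi5 -!exprM -!addrA size_polyDl ?size_polyXn mulnC //.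
rewrite ltnS; apply/leq_sizeP => i le_i.
by rewrite !coefE !gtn_eqF ?addr0 //; lia.
Qed.

(** Induction through [phi5 (y^2) = phi5 y * phi5 (- y)]: modulo 2 the new factor [phi5 (- y)]
    agrees with [phi5 y = P * h], so [h] becomes [P * h^2] and the exponent [e] of [P] becomes
    [2 * e + 1]. *)
Lemma phi5_pow2 (j : nat) :
  exists h s : {poly int},
    phi5 'X^(2 ^ j) = phi5 'X * h /\ h = phi5 'X ^+ (2 ^ j - 1) + 2%:R * s.
Proof.
elim: j => [|j [h [s [Ph hs]]]].
  by exists 1, 0; rewrite expn0 expr1 mulr1 subnn expr0 mulr0 addr0.
set y : {poly int} := 'X^(2 ^ j) in Ph.
set P := phi5 'X in Ph hs *; set u := P ^+ _ in hs.
(* With [h = u + 2 * s], the second witness is half of [P * h^2 - 2 * h * (y + y^3) - P * u^2]. *)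
exists (h * phi5 (- y)), (P * (2%:R * u * s + 2%:R * s ^+ 2) - h * (y + y ^+ 3)).
split; first by rewrite mulrA -Ph expnSr exprM -/y /phi5; ring.
have -> : P ^+ (2 ^ j.+1 - 1) = P * u ^+ 2.
  rewrite -exprM -exprS; congr (_ ^+ _); have := expn_gt0 2 j.
  by rewrite expnS; lia.
have -> : phi5 (- y) = P * h - 2%:R * (y + y ^+ 3) by rewrite -Ph /phi5; ring.
by rewrite hs; ring.
Qed.

Lemma integralOver_horner (L : fieldType) (q : {poly int}) (x : L) :
  integralOver (intr : int -> L) x ->
  integralOver (intr : int -> L) (map_poly intr q).[x].
Proof.
by move=> ix; apply: integral_horner => //; apply/integral_poly => i;
   rewrite coef_map /=; apply: integral_id.
Qed.

(** As [b] and [c] are themselves only integral, this rests on the transitivity of integrality. *)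
Lemma integral_quadratic (L : fieldType) (a b c : L) :
  integralOver (intr : int -> L) b -> integralOver (intr : int -> L) c ->
  a ^+ 2 = b * a + c -> integralOver (intr : int -> L) a.
Proof.
move=> ib ic eq_a; pose p := 'X^2 - (b *: 'X + c%:P).
have sz : (size (b *: 'X + c%:P)%R < size ('X^2 : {poly L}))%N.
  rewrite size_polyXn ltnS (leq_trans (size_polyD _ _)) // geq_max.
  by rewrite (leq_trans (size_scale_leq _ _)) ?size_polyX // (leq_trans (size_polyC_leq1 _)).
apply: (@integral_root_monic _ _ _ _ p).
- by rewrite monicE lead_coefDl ?size_polyN // lead_coefXn.
- by rewrite rootE !hornerE eq_a subrr.
apply/integral_poly => i; rewrite !coefE.
apply: integral_sub; first by apply: integral_nat.
apply: integral_add.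
  by apply: integral_mul => //; apply: integral_nat.
by case: ifP => // _; apply: integral0.
Qed.

Theorem theorem1p2 (A : int) (hA : (A = 1 %[mod 4])%Z) (n : nat)
    (hn : (3 <= n)%N) : ~ monogenic (calF_AA n A).
Proof.
case=> f_monic _ [L [theta [f_theta [basis free]]]].
have [k Ak] : exists k, A = 1 + 4%:R * k by exists (A %/ 4)%Z; lia.
have [h [s [Ph hs]]] := phi5_pow2 (n - 2).
set m := (2 ^ (n - 2))%N in Ph hs.
(* Since [m >= 2], one factor [P] can be split off [P ^+ (m - 1)] below. *)
have m_gt1 : (1 < m)%N by rewrite -{1}(expn0 2) ltn_exp2l //; lia.
pose R : {poly int} := k *: ('X^m ^+ 3 + 'X^m ^+ 2 + 'X^m).
have fE : calF_AA n A = phi5 'X * h + 4%:R * R.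
  rewrite -Ph /calF_AA /R /phi5 Ak.
  have -> : (2 ^ n = m * 4)%N by rewrite /m -[4%N]/(2 ^ 2)%N -expnD subnK //; lia.
  have -> : (2 ^ (n - 1) = m * 2)%N by rewrite /m -expnSr; congr (_ ^ _)%N; lia.
  rewrite -/m [(3 * m)%N]mulnC !exprM -!mul_polyC polyCD polyCM.
  have -> : (4%:R : int)%:P = 4%:R by rewrite rmorph_nat.
  by ring.
have sizeP : size (phi5 'X : {poly int}) = 5%N by rewrite -['X]expr1 size_phi5_Xn.
have P_neq0 : phi5 'X != 0 :> {poly int} by rewrite -size_poly_eq0 sizeP.
have sizePm := @size_phi5_Xn int m (ltnW m_gt1).
have h_neq0 : h != 0.
  by apply/eqP => h0; move: sizePm; rewrite Ph h0 mulr0 size_poly0.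
have size_h : (size h <= 4 * m)%N.
  by rewrite -ltnS -sizePm Ph size_mul // sizeP; exact: (leq_addl 3 (size h)).
have size_f : size (calF_AA n A) = (4 * m).+1.
  rewrite fE -Ph size_polyDl // sizePm ltnS.
  have -> : 4%:R * R = (4 * k) *: ('X^m ^+ 3 + 'X^m ^+ 2 + 'X^m).
    by rewrite /R -scalerA -[in RHS]mul_polyC rmorph_nat.
  rewrite (leq_trans (size_scale_leq _ _)) // -!exprM.
  apply/leq_sizeP => i le_i.
  by rewrite !coefE !gtn_eqF ?addr0 ?mulr0 //; lia.
(* Evaluate the factorization at 0, where [phi5 'X^m] and [phi5 'X] are both 1. *)
have h0 : h`_0 = 1.
  have := congr1 (horner^~ 0) Ph.
  by rewrite /phi5 !hornerE !expr0n /= ?expr0n; case: (m) m_gt1 => // ? _;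
     rewrite ?expr0n /= ?addr0 ?add0r ?mul1r horner_coef0.
pose ev (q : {poly int}) : L := (map_poly intr q).[theta].
have evD p q : ev (p + q) = ev p + ev q by rewrite /ev rmorphD hornerD.
have evM p q : ev (p * q) = ev p * ev q by rewrite /ev rmorphM hornerM.
have evX p i : ev (p ^+ i) = ev p ^+ i by rewrite /ev rmorphXn horner_exp.
have evn i : ev i%:R = i%:R by rewrite /ev rmorph_nat -polyC_natr hornerC.
have two_neq0 : 2%:R != 0 :> L.
  have := etrans (pchar_lalg L 2%N) (pchar_num rat 2%N).
  by rewrite inE /= => /negbT.
have theta_int : integralOver (intr : int -> L) theta.
  by exists (calF_AA n A).
have ev_int q := integralOver_horner q theta_int.
pose a := ev h / 2%:R.
have a2 : ev h = 2%:R * a by rewrite mulrC divfK.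
have a_sqr : a ^+ 2 = ev s * a + ev (- (R * phi5 'X ^+ (m - 2))).
  have Ph0 : ev (phi5 'X) * ev h = - (4%:R * ev R).
    apply/eqP; rewrite -subr_eq0 opprK -evM -(evn 4%N) -evM -evD -fE; exact: f_theta.
  have hE : ev h = ev (phi5 'X) * ev (phi5 'X) ^+ (m - 2) + 2%:R * ev s.
    rewrite {1}hs evD evX evM evn -exprS; congr (_ ^+ _ + _); lia.
  rewrite -mulNr evM evX -[- R]mulN1r evM.
  have -> : ev (-1) = -1 by rewrite /ev rmorphN rmorph1 -polyCN hornerC.
  (* Multiply by 4 and expand only one factor of [ev h * ev h]; the other one meets [ev (phi5 'X)]
     and yields [- 4 * ev R]. *)
  apply: (mulfI two_neq0); apply: (mulfI two_neq0).
  transitivity (ev h * ev h); first by rewrite a2; ring.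
  rewrite {1}hE mulrDl mulrAC Ph0 a2; ring.
have a_int : in_ring_of_integers <<1; theta>>%AS a.
  split; last exact: integral_quadratic (ev_int s) (ev_int _) a_sqr.
  rewrite rpred_div ?rpred_nat // /ev horner_coef rpred_sum // => i _.
  by rewrite coef_map rpredM ?rpred_int ?rpredX ?memv_adjoin.
have [c ac] := (basis a).1 a_int.
have d_gt0 : (0 < (size (calF_AA n A)).-1)%N by rewrite size_f /=; lia.
(* Both [2 * c i] and the coefficients of [h] are coordinates of [2 * a = ev h]. Freeness equates
   them, so [2 * c 0 = 1], which parity forbids. *)
have : c (Ordinal d_gt0) * 2 - h`_0 = 0.
  apply: (free (fun i => c i * 2 - h`_i)).
  under eq_bigr => i _ do rewrite mulrzBr mulrzA.
  rewrite sumrB -[X in X - _]mulrz_suml -ac.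
  apply/eqP; rewrite subr_eq0 -[_ *~ 2]/(a *+ 2) -mulr_natl -a2; apply/eqP.
  (* By [size_h], [h] has degree below that of f, so its coefficients padded with zeros fit the
     power basis. *)
  rewrite /ev (@horner_coef_wide _ (size (calF_AA n A)).-1); last first.
    by rewrite size_f (leq_trans (size_poly _ _)).
  by apply: eq_bigr => i _; rewrite coef_map /= mulrzl.
rewrite h0; lia.
Qed.
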